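(* Fix $\varepsilon\in(0,1/2)$ and let $c,\mu,L,M>0$ and an integer $n_0$ be constants, depending only on $\varepsilon$, with the following property: (P) whenever $(n,p,G,\beta,H,\Gamma)$ is an eligible tuple (with respect to $\varepsilon,c,\mu,M,n_0$), there is an $L/(pn)$-spread probability measure on the family of $\Gamma$-conflict-free Hamilton cycles of $H$. (Such constants exist for every $\varepsilon\in(0,1/2)$.) Then for every eligible tuple $(n,p,G,\beta,H,\Gamma)$, the graph $H$ contains at least $(pn/L)^n$ distinct $\Gamma$-conflict-free Hamilton cycles.
   Context: Graphs are finite and simple; $\delta,\Delta$ denote minimum and maximum degree. Hamilton cycles are identified with their edge sets. For $A,B\subseteq V(G)$ (not necessarily disjoint), $e_G(A,B)$ is the number of ordered pairs $(a,b)\in A\times B$ with $ab\in E(G)$. A graph $G$ is $(p,\beta)$-bijumbled if $\bigl|e_G(A,B)-p|A||B|\bigr|\le\beta\sqrt{|A||B|}$ for all $A,B\subseteq V(G)$. A tuple $(n,p,G,\beta,H,\Gamma)$ is called eligible (with respect to $\varepsilon,c,\mu,M,n_0$) if: $n\ge n_0$, $p\in(0,1]$, $pn\ge M$; $G$ is an $n$-vertex $(p,\beta)$-bijumbled graph with $\beta\le cpn$; $H$ is a spanning subgraph of $G$ such that either (absolute alternative) $\delta(H)\ge(\tfrac12+\varepsilon)pn$, or (relative alternative) $\deg_H(v)\ge(\tfrac12+\varepsilon)\deg_G(v)$ for every $v\in V(G)$ and $\delta(G)\ge(1-\varepsilon/4)pn$; and $\Gamma$ is a conflict graph on $E(H)$,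 i.e. a graph with vertex set $E(H)$, satisfying $\Delta(\Gamma)\le\mu pn$. A subgraph of $H$ is $\Gamma$-conflict-free if its edge set is an independent set in $\Gamma$. For a nonempty family $\mathcal F$ of subgraphs of a fixed graph $H$, a probability measure $\nu$ on $\mathcal F$ is $q$-spread if $\nu[\{F\in\mathcal F:S\subseteq E(F)\}]\le q^{|S|}$ for every $S\subseteq E(H)$. *)

(* Defs.v *)
From HB Require Import structures.
From mathcomp Require Import all_boot all_order all_algebra.
From mathcomp Require Import boolp classical_sets reals ereal measure.

Set Implicit Arguments.
Unset Strict Implicit.
Unset Printing Implicit Defensive.

Import Order.TTheory GRing.Theory Num.Theory.

Local Open Scope ring_scope.

Record sgraph (V : finType) := SGraph {
  adj :> rel V;
  adj_sym : symmetric adj;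
  adj_irr : irreflexive adj
}.

Section Graphs.
Variable V : finType.
Implicit Types (G H : sgraph V) (v : V) (A B : {set V}).

Definition degree G v : nat := #|[set w | G v w]|.

(* Degrees are at most #|V|, so the default value matters only if V is empty. *)
Definition min_degree G : nat := \big[minn/#|V|]_(v : V) degree G v.

Definition max_degree G : nat := \max_(v : V) degree G v.

Definition edges G : {set {set V}} :=
  [set [set xy.1; xy.2] | xy : V * V & G xy.1 xy.2].

Definition edge G : finType := {e : {set V} | e \in edges G}.

Definition spanning_subgraph H G : Prop := subrel H G.

Definition edge_count G A B : nat :=
  #|[set ab : V * V | [&& ab.1 \in A, ab.2 \in B & G ab.1 ab.2]]|.

Definition independent G A : bool := [forall x in A, forall y in A, ~~ G x y].

End Graphs.

Section HamiltonCycles.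
Variable V : finType.
Implicit Types (H : sgraph V).

(* The edge set of the cycle visiting the vertices of s in cyclic order. *)
Definition cycle_edges (s : seq V) : {set {set V}} :=
  [set [set x; next s x] | x in s].

(* C is the edge set of a Hamilton cycle of H.  A sequence of #|V| distinct
   vertices visits all of V; without 3 <= #|V| a single edge on two vertices
   would qualify. *)
Definition hamilton_cycle H (C : {set {set V}}) : bool :=
  (3 <= #|V|)%N &&
  [exists s : #|V|.-tuple V, ucycleb H s && (C == cycle_edges s)].

Definition conflict_free H (Gamma : sgraph (edge H)) (C : {set {set V}}) : bool :=
  (C \subset edges H) && independent Gamma [set e | val e \in C].

Definition cf_hamilton_cycles H (Gamma : sgraph (edge H)) : {set {set {set V}}} :=
  [set C | hamilton_cycle H C && conflict_free Gamma C].

End HamiltonCycles.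

(* {set T} with the sigma-algebra of all its subsets. *)
Definition discrete_sets (T : finType) : Type := {set T}.

Section DiscreteSets.
Variable T : finType.

HB.instance Definition _ := Choice.copy (discrete_sets T) {set T}.
HB.instance Definition _ := isPointed.Build (discrete_sets T) (@finset.set0 T).
HB.instance Definition _ := @isMeasurable.Build default_measure_display
  (discrete_sets T) (@discrete_measurable (discrete_sets T))
  (@discrete_measurable0 _) (@discrete_measurableC _) (@discrete_measurableU _).

End DiscreteSets.

Section Spread.
Variables (R : realType) (V : finType).

Definition bijumbled (p beta : R) (G : sgraph V) : Prop :=
  forall A B : {set V},
    `|(edge_count G A B)%:R - p * #|A|%:R * #|B|%:R|
      <= beta * Num.sqrt (#|A|%:R * #|B|%:R).

(* A probability measure on a family F of subgraphs, each given by its edge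
   set, is a probability measure on {set {set V}} giving F full measure;
   this also covers the requirement that F be nonempty. *)
Definition probability_on (F : {set {set {set V}}})
    (nu : probability (discrete_sets {set V}) R) : Prop :=
  (nu [set C | C \in F]%classic = 1)%E.

Definition spread (H : sgraph V) (F : {set {set {set V}}}) (q : R)
    (nu : probability (discrete_sets {set V}) R) : Prop :=
  forall S : {set {set V}}, S \subset edges H ->
    (nu [set C | C \in F /\ S \subset C]%classic <= (q ^+ #|S|)%:E)%E.

Record eligible (eps c mu M : R) (n0 : int) (n : nat) (p : R) (G : sgraph V)
    (beta : R) (H : sgraph V) (Gamma : sgraph (edge H)) : Prop := Eligible {
  eligible_n0 : n0 <= n%:Z;
  eligible_p : 0 < p <= 1;
  eligible_M : M <= p * n%:R;
  eligible_n : #|V| = n;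
  eligible_bijumbled : bijumbled p beta G;
  eligible_beta : beta <= c * p * n%:R;
  eligible_sub : spanning_subgraph H G;
  eligible_degree :
    (2^-1 + eps) * p * n%:R <= (min_degree H)%:R
    \/ (forall v : V, (2^-1 + eps) * (degree G v)%:R <= (degree H v)%:R)
       /\ (1 - eps / 4) * p * n%:R <= (min_degree G)%:R;
  eligible_conflict : (max_degree Gamma)%:R <= mu * p * n%:R
}.

End Spread.

Definition spread_property (R : realType) (eps c mu L M : R) (n0 : int) : Prop :=
  forall (V : finType) (n : nat) (p : R) (G : sgraph V) (beta : R)
      (H : sgraph V) (Gamma : sgraph (edge H)),
    eligible eps c mu M n0 n p G beta Gamma ->
    exists nu : probability (discrete_sets {set V}) R,
      probability_on (cf_hamilton_cycles Gamma) nu /\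
      spread H (cf_hamilton_cycles Gamma) (L / (p * n%:R)) nu.

(* Main.v *)
(* Every Hamilton cycle has exactly n edges, so a q-spread measure gives each
   single cycle mass at most q^n; the total mass 1 then forces the family to
   have at least q^-n members. *)

Require Import Defs.
From mathcomp Require Import all_boot all_order all_algebra.
From mathcomp Require Import classical_sets cardinality fsbigop reals ereal.
From mathcomp Require Import measure.

Import Order.TTheory GRing.Theory Num.Theory.

Local Open Scope ring_scope.

(** A union bound. Put [q = L/(pn)]. The family is covered by the events that a random cycle
    contains [C], for [C] in the family; spreadness makes each at most [q^n], so [1 <= q^n * #|F|]
    ([spread_card_ge1]). The combinatorial input is that a Hamilton cycle has exactly [n] edges
    ([card_cycle_edges]). *)

Lemma next_next_neq (T : eqType) (s : seq T) (x : T) :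
  uniq s -> (2 < size s)%N -> x \in s -> next s (next s x) != x.
Proof.
move=> us s_gt2 /rot_to[i s' Es].
rewrite -!(next_rot i us) Es.
move: us s_gt2; rewrite -(rot_uniq i) -(size_rot i) Es.
(* The rotated cycle reads [x, a, b, ...], so two steps from [x] lead to [b]. *)
case: s' {Es} => [|a [|b t]] //= /andP[+ /andP[_ _]] _.
rewrite !inE !negb_or => /and3P[xa xb _].
by rewrite eqxx [a == x]eq_sym (negbTE xa) eqxx eq_sym.
Qed.

(** Sending [x] to its outgoing edge is injective: distinct [x], [y] with the same edge would be
    each other's successors, which length at least 3 forbids. *)
Lemma card_cycle_edges (V : finType) (s : seq V) :
  uniq s -> (2 < size s)%N -> #|cycle_edges s| = size s.
Proof.
move=> us s_gt2; rewrite card_in_imset; first exact/card_uniqP.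
move=> x y xs ys /setP Exy; apply/eqP; apply: contraT => neq_xy.
have := Exy x; have := Exy y; rewrite !inE !eqxx /= (negbTE neq_xy) eq_sym.
rewrite (negbTE neq_xy) /= => /eqP yE /esym/eqP xE.
by have := @next_next_neq _ s x us s_gt2 xs; rewrite -yE -xE eqxx.
Qed.

Lemma card_hamilton_cycle (V : finType) (H : sgraph V) (C : {set {set V}}) :
  hamilton_cycle H C -> #|C| = #|V|.
Proof.
case/andP=> V_gt2 /existsP[s /andP[/andP[_ us] /eqP->]].
by rewrite card_cycle_edges ?size_tuple.
Qed.

Lemma spread_card_ge1 (R : realType) (V : finType) (H : sgraph V)
    (F : {set {set {set V}}}) (q : R) (m : nat)
    (nu : probability (discrete_sets {set V}) R) :
  (forall C, C \in F -> C \subset edges H /\ #|C| = m) ->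
  probability_on F nu -> spread H F q nu -> 1 <= q ^+ m * #|F|%:R.
Proof.
move=> FP nuF spF; rewrite -lee_fin -nuF.
(* This is the spread event for [S = C]; it contains the point [C] itself, whence the cover. *)
pose A (C : {set {set V}}) : set (discrete_sets {set V}) :=
  [set D | D \in F /\ C \subset D]%classic.
have FA : ([set C | C \in F] `<=` \bigcup_(C in [set` enum F]) A C)%classic.
  by move=> C CF; exists C; rewrite //= mem_enum.
apply: le_trans (content_sub_fsum nu (finite_seq _) (fun _ _ => I) I FA) _.
rewrite -fsbig_seq ?enum_uniq // big_enum /=.
have -> : (q ^+ m * #|F|%:R)%:E = (\sum_(C in F) (q ^+ m)%:E)%E.
  by rewrite sumEFin sumr_const mulr_natr.
by apply: lee_sum => C /FP[CH <-]; apply: spF.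
Qed.

Theorem corollary1p11 (R : realType) (eps : R) (heps : 0 < eps < 2^-1)
    (c mu L M : R) (hc : 0 < c) (hmu : 0 < mu) (hL : 0 < L) (hM : 0 < M)
    (n0 : int) (hP : spread_property eps c mu L M n0)
    (V : finType) (n : nat) (p : R) (G : sgraph V) (beta : R) (H : sgraph V)
    (Gamma : sgraph (edge H))
    (hel : eligible eps c mu M n0 n p G beta Gamma) :
  (p * n%:R / L) ^+ n <= #|cf_hamilton_cycles Gamma|%:R.
Proof.
have [nu [nuF spF]] := hP _ _ _ _ _ _ _ hel.
(* Positivity of [pn] and [L] lets the goal be divided through into the form [1 <= q^n * #|F|]. *)
have pn_gt0 : 0 < p * n%:R := lt_le_trans hM (eligible_M hel).
rewrite -[leLHS]mul1r -ler_pdivlMr ?exprn_gt0 ?divr_gt0 //.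
rewrite -exprVn invf_div mulrC; apply: spread_card_ge1 nuF spF => C.
rewrite inE => /andP[/card_hamilton_cycle -> /andP[CH _]].
by rewrite (eligible_n hel).
Qed.
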